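(* Let $1\le p<\infty$. Let $\boldsymbol{u}=(u_k)_{k\ge0}$ be an admissible sequence of polynomials in $\ell_p$ such that there exist $C>0$ and $0<\tau<1$ with $\|u_k\|_p\le C\tau^k$ for all $k\in\mathbb{N}$. Let $X$ be a complex random variable whose support is the whole complex plane and which satisfies: for some $\beta>0$, $\limsup_{r\to\infty}\big((\log r)^{1+\beta}\,\mathbb{P}(|X|\ge r)\big)<+\infty$. Let $(X_k)_{k\ge0}$ be a sequence of independent copies of $X$. Then, almost surely, the vector $v=\sum_{k\ge0}X_ku_k$ belongs to $E_p[\boldsymbol{u}]\subset\ell_p$. Moreover, for every $h\in c_{00}$ and every $\eta>0$, almost surely there exists a (realization-dependent) set $A\subseteq\mathbb{N}$ whose natural density exists and is positive such that $\|T_n(B[\boldsymbol{u}]^n)(v)-h\|_p<\eta$ for all $n\in A$.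
   Context: $\ell_p$ is the Banach space of complex sequences $x=(x_n)_{n\ge0}$ with $\|x\|_p=(\sum|x_n|^p)^{1/p}<\infty$, with unit vectors $(e_n)_{n\ge0}$; $c_{00}$ is the subspace of finitely supported sequences (''polynomials''); for nonzero $x\in c_{00}$, $\deg(x)=\max\{n: x_n\ne0\}$. A sequence $(u_k)_{k\ge0}$ in $c_{00}$ is admissible if $u_0=e_0$, $\deg(u_k)=k$ for $k\ge1$, and $\sum_k\|u_k\|_p<\infty$. $E_p[\boldsymbol{u}]=\{\sum_k x_ku_k: \sum_k|x_k|\|u_k\|_p<\infty\}$. $B[\boldsymbol{u}]$ is the operator on $E_p[\boldsymbol{u}]$ with $B[\boldsymbol{u}]u_0=0$, $B[\boldsymbol{u}]u_k=u_{k-1}$ ($k\ge1$). $T_n(B[\boldsymbol{u}]^n):E_p[\boldsymbol{u}]\to\ell_p$ is defined by $T_n(B[\boldsymbol{u}]^n)(\sum_{k\ge0}X_ku_k)=\sum_{k=0}^nX_{k+n}u_k$. The support of $X$ is the whole plane means $\mathbb{P}(X\in U)>0$ for every nonempty open $U\subset\mathbb{C}$. Natural density of $A\subseteq\mathbb{N}$: $\lim_n\#(A\cap[1,n])/n$. *)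

(* Defs.v *)
From HB Require Import structures.
From mathcomp Require Import all_boot all_order all_algebra.
From mathcomp Require Import all_classical all_reals all_analysis.
From mathcomp Require Import complex.
Set Implicit Arguments. Unset Strict Implicit. Unset Printing Implicit Defensive.
Import Order.TTheory GRing.Theory Num.Theory.
Import numFieldNormedType.Exports.
Local Open Scope classical_set_scope.
Local Open Scope ring_scope.

Section Defs.
Variable R : realType.
Local Notation C := R[i].

Definition cabs (z : C) : R := Normc.normc z.

(* ||x||_p for a complex sequence, as an extended real (+oo if x is not in l_p) *)
Definition lpnorm (p : R) (x : nat -> C) : \bar R :=
  ((\sum_(0 <= n <oo) ((cabs (x n)) `^ p)%:E) `^ p^-1)%E.

Definition e0 : nat -> C := fun n => if n == 0%N then 1 else 0.

Definition c00 (x : nat -> C) : Prop := exists N, forall n, (N <= n)%N -> x n = 0.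

Definition has_deg (x : nat -> C) (k : nat) : Prop :=
  x k != 0 /\ forall n, (k < n)%N -> x n = 0.

Definition admissible (p : R) (u : nat -> nat -> C) : Prop :=
  [/\ u 0%N = e0,
      (forall k, (1 <= k)%N -> has_deg (u k) k) &
      (\sum_(0 <= k <oo) lpnorm p (u k) < +oo)%E].

(* the coefficient sequence x defines an element sum_k x_k u_k of E_p[u] *)
Definition in_Ep (p : R) (u : nat -> nat -> C) (x : nat -> C) : Prop :=
  (\sum_(0 <= k <oo) ((cabs (x k))%:E * lpnorm p (u k)) < +oo)%E.

(* T_n(B[u]^n)(sum_k x_k u_k) = sum_{k=0}^n x_{k+n} u_k *)
Definition Tn (u : nat -> nat -> C) (n : nat) (x : nat -> C) : nat -> C :=
  fun m => \sum_(k < n.+1) x (k + n)%N * u k m.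

Definition copen (U : set C) : Prop :=
  forall z, U z -> exists2 e : R, 0 < e & forall w, cabs (w - z) < e -> U w.

Definition cmeasurable (B : set C) : Prop :=
  measurable [set q : R * R | B (Complex q.1 q.2)].

Definition cRV d (T : measurableType d) (X : T -> C) : Prop :=
  measurable_fun setT (fun w => complex.Re (X w)) /\ measurable_fun setT (fun w => complex.Im (X w)).

Definition cindependent d (T : measurableType d) (P : probability T R)
  (X : nat -> T -> C) : Prop :=
  forall (s : seq nat) (B : nat -> set C), uniq s ->
    (forall k, k \in s -> cmeasurable (B k)) ->
    P (\big[setI/setT]_(k <- s) (X k @^-1` B k)) =
    (\prod_(k <- s) P (X k @^-1` B k))%E.

Definition same_law d (T : measurableType d) (P : probability T R)
  (Y X0 : T -> C) : Prop :=
  forall B, cmeasurable B -> P (Y @^-1` B) = P (X0 @^-1` B).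

Definition full_support d (T : measurableType d) (P : probability T R)
  (X0 : T -> C) : Prop :=
  forall U : set C, copen U -> U !=set0 -> (0 < P (X0 @^-1` U))%E.

Definition pos_density (A : nat -> bool) : Prop :=
  exists2 delta : R, 0 < delta &
    (fun n : nat => (count A (iota 1 n))%:R / n%:R) @ \oo --> delta.

End Defs.

(* Main.v *)
Require Import Defs.
From HB Require Import structures.
From mathcomp Require Import all_boot all_order all_algebra.
From mathcomp Require Import all_classical all_reals all_analysis measurable_realfun.
From mathcomp Require Import complex ring lra zify.
Import Order.TTheory GRing.Theory Num.Theory.
Import numFieldNormedType.Exports.
Local Open Scope classical_set_scope.
Local Open Scope ring_scope.

(** Expand [h = sum_k a_k u_k], put [sigma = sqrt tau], and let [G n] be the
    event that [|X_(n+k) - a_k| < delta / sigma^k] for all [k]. On [G n] with [n]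
    at least the length of the expansion, [T_n(B^n) v - h] has norm less than
    [sum_k delta C sigma^k < eta]. By independence [P(G n)] is a constant
    infinite product [q]; the logarithmic tail bound makes it positive and shows
    that its partial products exceed it by [O(m^-beta)], whence
    [P(G n /\ G (n+m)) <= q^2 + O(m^-beta)]. A strong law of large numbers for
    such weakly dependent events, replacing Birkhoff's ergodic theorem, gives
    density [q] to the set of times [n] at which [G n] occurs. *)

(** * Power sums and infinite products *)

(** With [y = k + 2], dividing by [y^-b] leaves [1 + b / y <= (1 - 1/y)^-b], which follows from
    [ln (1 - 1/y) <= - 1/y] and [exp x >= 1 + x]. This is a discrete form of integrating
    [x^-(1+b)]. *)
Lemma powRN_telescope (R : realType) (b : R) (k : nat) : 0 < b ->
  b * k.+2%:R `^ (- (1 + b)) <= k.+1%:R `^ (- b) - k.+2%:R `^ (- b).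
Proof.
move=> b0; set y : R := k.+2%:R.
have y0 : 0 < y by rewrite ltr0n.
have x0 : 0 < k.+1%:R :> R by rewrite ltr0n.
have -> : k.+1%:R `^ (- b) = y `^ (- b) * (k.+1%:R / y) `^ (- b).
  by rewrite -powRM ?divr_ge0// 1?ltW// mulrCA divff ?mulr1 ?gt_eqF.
have -> : y `^ (- (1 + b)) = y `^ (- b) * y^-1.
  rewrite opprD addrC powRD; last by apply/implyP => _; rewrite gt_eqF.
  by rewrite powR_inv1 ?(ltW y0).
have hb : 1 + b / y <= (k.+1%:R / y) `^ (- b).
  rewrite /powR mulf_eq0 invr_eq0 (gt_eqF x0) (gt_eqF y0)/=.
  apply: le_trans (expR_ge1Dx _).
  suff : ln (k.+1%:R / y) <= - y^-1 by rewrite lerD2l -(ler_pM2l b0) mulrN mulNr lerNr.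
  have -> : k.+1%:R / y = 1 - y^-1 :> R.
    have -> : k.+1%:R = y - 1 by rewrite /y -[k.+2%:R]natr1 addrK.
    by rewrite mulrBl divff ?gt_eqF// mul1r.
  apply: le_ln1Dx.
  by rewrite ltrN2 invf_lt1// ltr1n.
rewrite mulrCA -[X in _ <= _ - X]mulr1 -mulrBr ler_pM2l ?powR_gt0//.
by rewrite lerBrDl.
Qed.

Lemma powRN_anti (R : realType) (b x y : R) : 0 <= b -> 0 < x -> x <= y ->
  y `^ (- b) <= x `^ (- b).
Proof.
move=> b0 x0 xy; have y0 := lt_le_trans x0 xy.
rewrite !powRN lef_pV2 ?posrE ?powR_gt0//.
by apply: ge0_ler_powR; rewrite ?nnegrE ?(ltW x0) ?(ltW y0).
Qed.

(** The [1] in the constant pays for the term [k = m], where the exponent is merely weakened to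
    [- b]; the remaining terms telescope and cost [b^-1]. *)
Lemma sum_powRN_tail (R : realType) (b : R) (m n : nat) : 0 < b ->
  \sum_(m <= k < n) k.+1%:R `^ (- (1 + b)) <= (1 + b^-1) * m.+1%:R `^ (- b).
Proof.
move=> b0.
have [nm|mn] := leqP n m.
  by rewrite big_geq// mulr_ge0 ?powR_ge0// addr_ge0// invr_ge0 ltW.
rewrite big_ltn// mulrDl mul1r lerD//.
  by apply: ler_powR; [rewrite ler1n|lra].
rewrite mulrC ler_pdivlMr// mulrC -(subnK mn) addnC.
move: (n - m.+1)%N => {n mn} n.
apply: (@le_trans _ _ (m.+1%:R `^ (- b) - (m.+1 + n)%:R `^ (- b))); last first.
  by rewrite gerBl powR_ge0.
elim: n => [|n IH]; first by rewrite addn0 big_geq// mulr0 subrr.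
rewrite addnS big_nat_recr ?leq_addr//= mulrDr.
have := @powRN_telescope _ _ (m + n) b0.
rewrite addSn; move: IH; rewrite addSn; lra.
Qed.

Lemma powRN_summable (R : realType) (b c : R) : 0 < b -> 0 <= c ->
  (\sum_(0 <= k <oo) (c * k.+1%:R `^ (- (1 + b)))%:E < +oo)%E.
Proof.
move=> b0 c0; apply: (@le_lt_trans _ _ (c * (1 + b^-1))%:E); last exact: ltry.
apply: lime_le; first by apply: is_cvg_nneseries => k _ _; rewrite lee_fin mulr_ge0// powR_ge0.
apply: nearW => n; rewrite sumEFin lee_fin -mulr_sumr ler_wpM2l//.
by have := @sum_powRN_tail _ _ 0 n b0; rewrite powR1 mulr1.
Qed.

(** Weierstrass's product inequality, by induction on the number of factors. *)
Lemma prod_ge_sum_compl (R : realType) (b : nat -> R) (m n : nat) :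
  (forall k, 0 <= b k <= 1) ->
  1 - \sum_(m <= k < n) (1 - b k) <= \prod_(m <= k < n) b k <= 1.
Proof.
move=> b01.
have [nm|/ltnW mn] := leqP n m; first by rewrite !big_geq// subr0 lexx.
rewrite -(subnK mn) addnC; move: (n - m)%N => {n mn} n.
elim: n => [|n /andP[IH1 IH2]]; first by rewrite addn0 !big_geq// subr0 lexx.
rewrite addnS !big_nat_recr ?leq_addr//=.
set s := \sum_(_ <= _ < _) _ in IH1 *; set pr := \prod_(_ <= _ < _) _ in IH1 IH2 *.
have pr0 : 0 <= pr by apply: prodr_ge0 => k _; have /andP[] := b01 k.
have /andP[] := b01 (m + n)%N.
set x := b _ => x0 x1; apply/andP; split; nra.
Qed.

(* The limit is positive because the tail product is at least one minus the
   tail sum of the [1 - b k]. *)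
Lemma infinite_product (R : realType) (b : nat -> R) (beta c : R) :
  0 < beta -> (forall k, 0 < b k <= 1) ->
  (forall k, 1 - b k <= c * k.+1%:R `^ (- (1 + beta))) ->
  exists q C : R, [/\ 0 < q <= 1, 0 <= C,
    (fun n => \prod_(0 <= k < n) b k) @ \oo --> q &
    forall m, \prod_(0 <= k < m) b k <= q + C * m.+1%:R `^ (- beta)].
Proof.
move=> beta0 b01 bc.
have b01' k : 0 <= b k <= 1 by have /andP[/ltW-> ->] := b01 k.
pose pi n := \prod_(0 <= k < n) b k.
have pi_ge0 n : 0 < pi n by apply: prodr_gt0 => k _; have /andP[] := b01 k.
have pi_cat m n : (m <= n)%N -> pi n = pi m * \prod_(m <= k < n) b k.
  by move=> mn; rewrite /pi (@big_cat_nat _ _ _ m).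
have pi_le1 n : pi n <= 1 by have /andP[] := prod_ge_sum_compl _ _ 0 n b01'.
have pi_ni : nonincreasing_seq pi.
  move=> m n mn; rewrite (pi_cat _ _ mn) ger_pMr//.
  by have /andP[] := prod_ge_sum_compl _ _ m n b01'.
have c0 : 0 <= c.
  have := bc 0%N; rewrite powR1 mulr1; apply: le_trans.
  by have /andP[_] := b01 0%N; rewrite subr_ge0.
pose C := c * (1 + beta^-1).
have C0 : 0 <= C by rewrite mulr_ge0// addr_ge0// invr_ge0 ltW.
have tail m n : \sum_(m <= k < n) (1 - b k) <= C * m.+1%:R `^ (- beta).
  apply: (@le_trans _ _ (\sum_(m <= k < n) c * k.+1%:R `^ (- (1 + beta)))).
    exact: ler_sum.
  by rewrite -mulr_sumr /C -mulrA ler_wpM2l// sum_powRN_tail.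
have pi_cvg : cvgn pi.
  apply: nonincreasing_is_cvgn => //.
  by exists 0 => _ [n _ <-]; exact: ltW.
have pi_lb m : pi m * (1 - C * m.+1%:R `^ (- beta)) <= limn pi.
  apply: limr_ge => //; near=> n.
  have mn : (m <= n)%N by near: n; exact: nbhs_infty_ge.
  rewrite (pi_cat _ _ mn) ler_pM2l//.
  have /andP[+ _] := prod_ge_sum_compl _ _ m n b01'; apply: le_trans.
  by rewrite lerD2l lerN2.
exists (limn pi), C; split => //; last first.
  (* Writing [x] for the error, [pi_lb] reads [pi m <= q + pi m * x], and [pi m <= 1] removes the
     factor in front of [x]. *)
  move=> m; have := pi_lb m; have := pi_le1 m; have := pi_ge0 m.
  have : 0 <= C * m.+1%:R `^ (- beta) by rewrite mulr_ge0 ?powR_ge0.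
  by rewrite -/(pi m); set x := C * _; nra.
have -> /= : limn pi <= 1 by apply: limr_le => //; exact: nearW.
rewrite andbT.
have [m hm] : exists m, C * m.+1%:R `^ (- beta) < 1.
  (* Any [m] beyond [(C + 1)^(1/beta)] makes the tail sum less than 1, and [pi_lb m] then bounds the
     limit below by a positive number. *)
  exists (Num.bound ((C + 1) `^ beta^-1)).
  set m := Num.bound _.
  have hm : (C + 1) `^ beta^-1 < m.+1%:R.
    by apply: lt_trans (archi_boundP (powR_ge0 _ _)) _; rewrite ltr_nat.
  have : C + 1 < m.+1%:R `^ beta.
    have -> : C + 1 = ((C + 1) `^ beta^-1) `^ beta.
      by rewrite -powRrM mulVf ?gt_eqF// powRr1// addr_ge0.
    by apply: gt0_ltr_powR => //; rewrite nnegrE ?powR_ge0.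
  rewrite powRN ltr_pdivrMr ?powR_gt0// mul1r; lra.
by apply: lt_le_trans (pi_lb m); rewrite mulr_gt0// subr_gt0.
Unshelve. all: by end_near.
Qed.

(** * A strong law of large numbers under weak dependence *)

(** For [n] between consecutive [t]-th powers, monotonicity of [c] traps [c n / n] between [lo] and
    [up], which pair the count at one power with the other power as denominator. Both tend to [q]
    because the ratio of consecutive powers tends to 1. *)
Lemma cvg_subpolynomial_averages (R : realType) (c : nat -> R) (q : R) (t : nat) :
  (0 < t)%N -> nondecreasing_seq c -> (forall n, 0 <= c n) ->
  (fun j => c (j.+1 ^ t)%N / (j.+1 ^ t)%:R) @ \oo --> q ->
  (fun n => c n / n%:R) @ \oo --> q.
Proof.
move=> t0 cnd c0 cq.
pose N j : R := (j.+1 ^ t)%:R.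
have N0 j : 0 < N j by rewrite ltr0n expn_gt0.
have ratio : (fun j => N j.+1 / N j) @ \oo --> (1 : R).
  have -> : (fun j => N j.+1 / N j) = (fun j => (1 + harmonic j) ^+ t).
    apply/funext => j; rewrite /N !natrX -expr_div_n; congr (_ ^+ _).
    by rewrite -[j.+2%:R]natr1 mulrDl divff// mul1r.
  have h1 : (fun j => 1 + harmonic j : R) @ \oo --> (1 : R).
    by rewrite -[X in _ --> X]addr0; apply: cvgD; [exact: cvg_cst|exact: cvg_harmonic].
  rewrite -[X in _ --> X](expr1n R t).
  exact: (cvg_comp _ _ h1 (@exprn_continuous R t 1)).
pose lo j := c (j.+1 ^ t)%N / N j.+1.
pose up j := c (j.+2 ^ t)%N / N j.
have lo_q : lo @ \oo --> q.
  rewrite (_ : lo = (fun j => c (j.+1 ^ t)%N / N j * (N j.+1 / N j)^-1)); last first.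
    by apply/funext => j; rewrite /lo; field; rewrite !gt_eqF.
  rewrite -[X in _ --> X]mulr1; apply: cvgM => //.
  by rewrite -[X in _ --> X]invr1; apply: cvgV.
have up_q : up @ \oo --> q.
  rewrite (_ : up = (fun j => c (j.+2 ^ t)%N / N j.+1 * (N j.+1 / N j))); last first.
    by apply/funext => j; rewrite /up; field; rewrite !gt_eqF.
  rewrite -[X in _ --> X]mulr1; apply: cvgM => //.
  by move: cq; rewrite -cvg_shiftS; apply.
(* The index [j] is one less than the integer [t]-th root of [n]; at [n = 0] its value is
   arbitrary. *)
have ex_root n : exists j, (0 < n)%N -> (j.+1 ^ t <= n < j.+2 ^ t)%N.
  have [->|n0] := posnP n; first by exists 0%N.
  have ex1 : exists j, (j.+1 ^ t <= n)%N by exists 0%N; rewrite exp1n.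
  have ub1 j : (j.+1 ^ t <= n)%N -> (j <= n)%N.
    apply: leq_trans; rewrite (leq_trans (leqnSn _))//.
    by rewrite -{1}(expn1 j.+1) leq_pexp2l.
  case: (ex_maxnP ex1 ub1) => j jn jmax; exists j => _; rewrite jn/= ltnNge.
  by apply/negP => /jmax; rewrite ltnn.
have [root rootP] := choice ex_root.
have root_oo : root @ \oo --> \oo.
  apply/cvgnyPge => M; near=> n.
  have n0 : (0 < n)%N by near: n; exact: nbhs_infty_gt.
  have /andP[_ nj] := rootP n n0.
  rewrite -2!ltnS -(@ltn_exp2r _ _ t)// (leq_ltn_trans _ nj)//.
  by near: n; exact: nbhs_infty_ge.
apply: (@squeeze_cvgr _ _ _ _ (lo \o root) (up \o root)); last 2 first.
- exact: cvg_comp root_oo lo_q.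
- exact: cvg_comp root_oo up_q.
near=> n.
have n0 : (0 < n)%N by near: n; exact: nbhs_infty_gt.
have /andP[nj1 nj2] := rootP n n0.
have n0R : 0 < n%:R :> R by rewrite ltr0n.
apply/andP; split; rewrite /= /lo /up.
  apply: ler_pM; [exact: c0|by rewrite invr_ge0 ltW|exact: cnd|].
  by rewrite lef_pV2 ?posrE// ler_nat ltnW.
apply: ler_pM; [exact: c0|by rewrite invr_ge0 ltW|exact/cnd/ltnW|].
by rewrite lef_pV2 ?posrE// ler_nat.
Unshelve. all: by end_near.
Qed.

(** Counts, for fixed [i], the indices at distance less than [L]: the pairs for which no
    decorrelation is available. *)
Lemma card_near_diagonal (n L i : nat) :
  (\sum_(0 <= j < n) ((i < j + L) && (j < i + L)) <= 2 * L)%N.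
Proof.
rewrite -big_mkcond/= sum1_count /index_iota subn0 -size_filter.
rewrite -(size_iota (i.+1 - L) (2 * L)); apply: uniq_leq_size.
  by rewrite filter_uniq// iota_uniq.
by move=> j; rewrite mem_filter !mem_iota; lia.
Qed.

Section second_moment.
Context d (T : measurableType d) (R : realType) (P : probability T R).
Variables (G : nat -> set T) (q e : R) (L : nat).
Hypotheses (mG : forall n, measurable (G n)) (PG : forall n, P (G n) = q%:E).
Hypothesis e_ge0 : 0 <= e.
Hypothesis PGG : forall n m, (L <= m)%N ->
  (P (G n `&` G (n + m)%N) <= (q ^+ 2 + e)%:E)%E.

Let indic_Lfun1 (A : set T) : measurable A -> (\1_A : T -> R) \in Lfun P 1.
Proof. by move=> mA; rewrite inE; apply/Lfun1_integrable; exact: integrable_indic. Qed.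

(** Distant pairs obey [PGG], after exchanging [i] and [j] if needed; near pairs get the trivial
    bound 1, recorded by the 0-1 summand. *)
Let pair_bound i j :
  (P (G i `&` G j) <= (q ^+ 2 + e + ((i < j + L) && (j < i + L))%N%:R)%:E)%E.
Proof.
have [/andP[ij ji]|] := boolP ((i < j + L) && (j < i + L))%N.
  apply: (le_trans (probability_le1 P (measurableI _ _ (mG i) (mG j)))).
  by rewrite lee_fin lerDr addr_ge0// sqr_ge0.
rewrite addr0; case/nandP; rewrite -leqNgt => h.
  have ji : (j <= i)%N := leq_trans (leq_addr _ _) h.
  by rewrite setIC -(subnKC ji); apply: PGG; rewrite leq_subRL.
have ij : (i <= j)%N := leq_trans (leq_addr _ _) h.
by rewrite -(subnKC ij); apply: PGG; rewrite leq_subRL.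
Qed.

(** Expand the square. The mean of the count is [n q]; its second moment is at most [n^2 (q^2 + e)]
    plus the number of near pairs, itself at most [2 L n]. After division by [n^2] the [q^2] terms
    cancel. *)
Lemma second_moment_average (n : nat) : (0 < n)%N ->
  (\int[P]_w (((\sum_(0 <= i < n) \1_(G i) w) / n%:R - q) ^+ 2)%:E
    <= (2 * L%:R / n%:R + e)%:E)%E.
Proof.
move=> n0; have n0R : 0 < n%:R :> R by rewrite ltr0n.
(* The count and its square are written as sums over lists of functions, the shape in which
   [expectation_sum] applies. *)
pose S1 : T -> R := \sum_(f <- [seq (\1_(G i) : T -> R) | i <- index_iota 0 n]) f.
pose S2 : T -> R := \sum_(f <- [seq (\1_(G i `&` G j) : T -> R) | i <- index_iota 0 n, j <- index_iota 0 n]) f.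
have S1E w : S1 w = \sum_(0 <= i < n) \1_(G i) w.
  by rewrite /S1 big_map fct_sumE.
have S2E w : S2 w = (S1 w) ^+ 2.
  rewrite S1E expr2 mulr_suml /S2 big_allpairs_dep fct_sumE.
  apply: eq_bigr => i _; rewrite fct_sumE mulr_sumr.
  by apply: eq_bigr => j _; rewrite indicI.
have S1L : S1 \in Lfun P 1.
  by rewrite /S1 big_map; apply: rpred_sum => i _; exact: indic_Lfun1.
have S2L : S2 \in Lfun P 1.
  rewrite /S2 big_allpairs_dep; apply: rpred_sum => i _; apply: rpred_sum => j _.
  by apply: indic_Lfun1; exact: measurableI.
have ES1 : ('E_P[S1] = (n%:R * q)%:E)%E.
  rewrite expectation_sum; last by move=> f /mapP[i _ ->]; exact: indic_Lfun1.
  rewrite big_map (eq_bigr (fun=> q%:E)).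
    by rewrite sumEFin sumr_const_nat subn0 mulr_natl.
  by move=> i _; rewrite expectation_indic// PG.
have ES2 : ('E_P[S2] <= (n%:R ^+ 2 * (q ^+ 2 + e) + n%:R * (2 * L%:R))%:E)%E.
  rewrite expectation_sum; last first.
    by move=> f /allpairsP[[i j] [_ _ ->]]; apply: indic_Lfun1; exact: measurableI.
  rewrite big_allpairs_dep.
  apply: (@le_trans _ _ (\sum_(0 <= i < n) (\sum_(0 <= j < n)
      (q ^+ 2 + e + ((i < j + L) && (j < i + L))%N%:R)%:E))%E).
    apply: lee_sum => i _; apply: lee_sum => j _.
    by rewrite expectation_indic//; exact: measurableI.
  under eq_bigr do rewrite sumEFin.
  rewrite sumEFin lee_fin.
  under eq_bigr do rewrite big_split/= sumr_const_nat subn0.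
  rewrite big_split/= sumr_const_nat subn0 lerD//.
    by rewrite -[X in X <= _]mulr_natl -[X in _ * X <= _]mulr_natl mulrA.
  apply: (@le_trans _ _ (\sum_(0 <= i < n) (2 * L%:R : R))).
    apply: ler_sum => i _; rewrite -natr_sum -natrM ler_nat.
    exact: card_near_diagonal.
  by rewrite sumr_const_nat subn0 -[X in X <= _]mulr_natl.
pose D : T -> R := ((n%:R ^- 2) \o* S2 \- (2 * q / n%:R) \o* S1) \+ cst (q ^+ 2).
have DE w : D w = ((\sum_(0 <= i < n) \1_(G i) w) / n%:R - q) ^+ 2.
  by rewrite /D /= S2E -S1E; field; rewrite gt_eqF.
under eq_integral do rewrite -DE.
have -> : (\int[P]_w (D w)%:E = 'E_P[D])%E by rewrite unlock.
rewrite expectationD ?Lfun_cst ?rpredB ?Lfun_scale//.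
rewrite expectationB ?Lfun_scale// expectation_cst.
rewrite (expectationZl _ S2L) (expectationZl _ S1L) ES1.
move: ES2; have : ('E_P[S2] \is a fin_num)%E by exact: expectation_fin_num.
move=> /fineK <-; rewrite -!(EFinM, EFinB, EFinD) !lee_fin; set s := fine _ => hs.
rewrite -(ler_pM2l (exprn_gt0 2 n0R)).
have -> : n%:R ^+ 2 * (n%:R ^- 2 * s - 2 * q / n%:R * (n%:R * q) + q ^+ 2)
    = s - n%:R ^+ 2 * q ^+ 2 by field; rewrite gt_eqF.
have -> : n%:R ^+ 2 * (2 * L%:R / n%:R + e) = n%:R * (2 * L%:R) + n%:R ^+ 2 * e.
  by field; rewrite gt_eqF.
by lra.
Qed.
End second_moment.

(* Along [n = (j+1)^(2s)] the second moments are summable, so the averages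
   converge almost surely there; monotonicity of the counts fills the gaps. *)
Lemma strong_law_weakly_dependent d (T : measurableType d) (R : realType)
    (P : probability T R) (G : nat -> set T) (q C beta : R) :
  (forall n, measurable (G n)) -> (forall n, P (G n) = q%:E) ->
  0 < beta -> 0 <= C ->
  (forall n m, (P (G n `&` G (n + m)%N) <=
                (q ^+ 2 + C * m.+1%:R `^ (- beta))%:E)%E) ->
  {ae P, forall w,
    (fun n => (\sum_(0 <= i < n) \1_(G i) w) / n%:R : R) @ \oo --> q}.
Proof.
move=> mG PG beta0 C0 PGG.
(* The exponent satisfies both [s >= 2] and [s * beta >= 2]. With window [L = (j+1)^s] and
   [N j = L^2], the near-pair term [2 L / N j] and the decorrelation error [C L^-beta] are then both
   of order [(j+1)^-2]. *)
pose s := (Num.bound (2 / beta)).+2.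
have sbeta : 2 <= s%:R * beta.
  rewrite -ler_pdivrMr// ltW//.
  apply: lt_trans (archi_boundP _) _; first by rewrite divr_ge0// ltW.
  by rewrite ltr_nat.
pose N j := (j.+1 ^ (s * 2))%N.
pose D j w := ((\sum_(0 <= i < N j) \1_(G i) w) / (N j)%:R - q : R) ^+ 2.
have D0 j w : 0 <= D j w by exact: sqr_ge0.
have ID j : (\int[P]_w (D j w)%:E <=
    ((2 + C) * j.+1%:R `^ (- (1 + 1)))%:E)%E.
  pose L := (j.+1 ^ s)%N.
  pose e : R := C * L%:R `^ (- beta).
  have L0 : 0 < L%:R :> R by rewrite ltr0n expn_gt0.
  have e_ge0 : 0 <= e by rewrite mulr_ge0 ?powR_ge0.
  have PGGe n m : (L <= m)%N -> (P (G n `&` G (n + m)%N) <= (q ^+ 2 + e)%:E)%E.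
    move=> Lm; apply: le_trans (PGG n m) _; rewrite lee_fin lerD2l ler_wpM2l//.
    by apply: powRN_anti => //; [exact: ltW|rewrite ler_nat (leq_trans Lm)].
  have N0 : (0 < N j)%N by rewrite expn_gt0.
  apply: (le_trans (second_moment_average _ _ _ _ _ _ _ _ mG PG e_ge0 PGGe _ N0)).
  rewrite lee_fin [leRHS]mulrDl.
  have Lpow : L%:R = j.+1%:R `^ s%:R :> R by rewrite natrX powR_mulrn.
  apply: lerD.
    have -> : 2 * L%:R / (N j)%:R = 2 * L%:R^-1 :> R.
      by rewrite /N expnM -/L natrX; field; rewrite gt_eqF.
    rewrite ler_wpM2l// Lpow -powRN ler_powR ?ler1n// lerN2.
    by rewrite (_ : 1 + 1 = 2%:R)// ler_nat.
  rewrite /e ler_wpM2l// Lpow -powRrM mulrN ler_powR ?ler1n// lerN2.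
  by rewrite (_ : 1 + 1 = 2).
have mD j : measurable_fun setT (D j).
  apply: measurable_funX; apply: measurable_funB => //.
  apply: measurable_funM => //; apply: measurable_sum => i.
  exact: measurable_indic.
(* The expected sum of all [D j] is finite, so almost surely the series converges and its terms tend
   to 0. *)
have sumD : P.-integrable setT (fun w => \sum_(0 <= j <oo) (D j w)%:E)%E.
  apply/integrableP; split.
    apply: ge0_emeasurable_sum => [j w _ _|j _]; first by rewrite lee_fin.
    exact/measurable_EFinP.
  rewrite (eq_integral (fun w => (\sum_(0 <= j <oo) (D j w)%:E)%E)); last first.
    by move=> w _; rewrite gee0_abs// nneseries_ge0// => j _ _; rewrite lee_fin.
  rewrite integral_nneseries//; last 2 first.
  - by move=> j; exact/measurable_EFinP.
  - by move=> j w _; rewrite lee_fin.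
  have C2 : 0 <= 2 + C by rewrite addr_ge0.
  apply: (le_lt_trans _ (powRN_summable _ _ _ ltr01 C2)).
  apply: lee_nneseries => [j _ _|j _]; last exact: ID.
  by apply: integral_ge0 => w _; rewrite lee_fin.
apply: filterS (integrable_ae measurableT sumD) => w /(_ I) finD.
have Dw : (fun j => D j w) @ \oo --> (0 : R).
  apply: cvg_series_cvg_0; apply: nnseries_is_cvg => //.
  by rewrite ltey_eq finD.
apply: (@cvg_subpolynomial_averages _ (fun n => \sum_(0 <= i < n) \1_(G i) w) _ (s * 2)) => //.
- apply/nondecreasing_seqP => n.
  by rewrite big_nat_recr//= lerDl.
- by move=> n; apply: sumr_ge0.
apply/cvgrPdist_lt => /= eps eps0.
have /cvgrPdist_lt /(_ (eps ^+ 2)) := Dw.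
rewrite exprn_gt0// => /(_ isT); apply: filterS => j.
rewrite sub0r normrN ger0_norm// /D -real_normK ?num_real// distrC.
by rewrite ltr_pXn2r// nnegrE ltW.
Qed.

(** * Events of a sequence of independent complex variables *)

Definition cball (R : realType) (a : R[i]) (r : R) : set R[i] :=
  [set z | cabs (z - a) < r].
Arguments cball {R} a r.

Lemma cmeasurable_cball (R : realType) (a : R[i]) (r : R) :
  cmeasurable (cball a r).
Proof.
rewrite /cmeasurable; case: a => a1 a2.
pose f (z : R * R) : R := Num.sqrt ((z.1 - a1) ^+ 2 + (z.2 - a2) ^+ 2).
rewrite (_ : [set _ | _] = setT `&` f @^-1` `]-oo, r[); last first.
  by rewrite setTI; apply/seteqP; split => z /=; rewrite in_itv.
have mf : measurable_fun setT f.
  have msqrt : measurable_fun setT (@Num.sqrt R).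
    by apply: continuous_measurable_fun; exact: sqrt_continuous.
  apply: (measurableT_comp msqrt).
  by apply: measurable_funD; apply: measurable_funX; apply: measurable_funB.
by apply: mf => //; exact: measurable_itv.
Qed.

Lemma measurable_cRV_preimage d (T : measurableType d) (R : realType)
    (Y : T -> R[i]) (B : set R[i]) :
  cRV Y -> cmeasurable B -> measurable (Y @^-1` B).
Proof.
move=> [mre mim] mB.
have mY := measurable_fun_pair mre mim.
have := mY measurableT _ mB; rewrite setTI; congr measurable.
by apply/seteqP; split => w /=; case: (Y w).
Qed.

Section independent_sequence.
Context d (T : measurableType d) (R : realType) (P : probability T R).
Variables (X0 : T -> R[i]) (X : nat -> T -> R[i]).
Hypotheses (mX : forall k, cRV (X k)) (lawX : forall k, same_law P (X k) X0).
Hypothesis indepX : cindependent P X.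

(** The event is the decreasing intersection of the [F N], which constrain only [N] coordinates.
    Independence and equality of laws give [P (F N)] as a partial product, whatever the shift [n];
    continuity from above passes to the limit. *)
Lemma probability_all (B : nat -> set R[i]) (n : nat) (l : R) :
  (forall k, cmeasurable (B k)) ->
  (fun N => \prod_(0 <= k < N) fine (P (X0 @^-1` B k))) @ \oo --> l ->
  measurable [set w | forall k, B k (X (n + k)%N w)] /\
  P [set w | forall k, B k (X (n + k)%N w)] = l%:E.
Proof.
move=> mB Bl.
pose F N := \bigcap_(k in [set` index_iota 0 N]) (X (n + k)%N @^-1` B k).
have mXB k : measurable (X (n + k)%N @^-1` B k) by exact: measurable_cRV_preimage.
have mF N : measurable (F N).
  by rewrite /F bigcap_seq; apply: bigsetI_measurable => k _.
have FE : \bigcap_N F N = [set w | forall k, B k (X (n + k)%N w)].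
  apply/seteqP; split => w /=; last by move=> h N _ k _ /=; exact: h.
  by move=> h k; apply: (h k.+1 I k); rewrite /= mem_index_iota ltnS leqnn.
have mall : measurable (\bigcap_N F N) by apply: bigcapT_measurable.
split; first by rewrite -FE.
have PF N : P (F N) = (\prod_(0 <= k < N) fine (P (X0 @^-1` B k)))%:E.
  (* Independence is indexed by absolute positions, so the target sets are shifted back by [n]. *)
  have := @indepX [seq (n + k)%N | k <- index_iota 0 N] (fun k => B (k - n)%N).
  rewrite !big_map map_inj_uniq ?iota_uniq; last exact: addnI.
  move=> /(_ isT) h; rewrite /F bigcap_seq.
  transitivity (P (\big[setI/setT]_(0 <= k < N) (X (n + k)%N @^-1` B (n + k - n)%N))).
    by congr (P _); apply: eq_bigr => k _; rewrite addKn.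
  rewrite h; last by move=> k _; exact: mB.
  rewrite (big_morph EFin EFinM erefl); apply: eq_bigr => k _.
  rewrite addKn (lawX (n + k)%N _ (mB k)) fineK//.
  by rewrite -(lawX (n + k)%N _ (mB k)) fin_num_measure.
rewrite -FE; apply: (@cvg_unique _ (@ereal_hausdorff R) (P \o F @ \oo)).
  apply: nonincreasing_cvg_mu => //.
    by rewrite (le_lt_trans (probability_le1 P (mF 0%N)))// ltry.
  move=> M N MN; apply/subsetPset => w h k /= kM; apply: h => /=.
  by move: kM; rewrite !mem_index_iota => /andP[_ kM]; rewrite (leq_trans kM).
apply: cvg_EFin; first by apply: nearW => N; rewrite /= PF.
by rewrite (_ : fine \o _ = (fun N => \prod_(0 <= k < N) fine (P (X0 @^-1` B k))))//;
  apply/funext => N; rewrite /= PF.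
Qed.

(** Keep the first event's conditions on the first [m] coordinates only, and the whole second event.
    These concern disjoint sets of coordinates and together form one event of the same type, for the
    concatenated targets [B'], whose infinite product factors. *)
Lemma probability_pair_le (B : nat -> set R[i]) (n m : nat) (q : R) :
  (forall k, cmeasurable (B k)) ->
  (fun N => \prod_(0 <= k < N) fine (P (X0 @^-1` B k))) @ \oo --> q ->
  (P ([set w | forall k, B k (X (n + k)%N w)] `&`
      [set w | forall k, B k (X (n + m + k)%N w)])
   <= (\prod_(0 <= k < m) fine (P (X0 @^-1` B k)) * q)%:E)%E.
Proof.
move=> mB Bq.
pose B' k := if (k < m)%N then B k else B (k - m)%N.
have mB' k : cmeasurable (B' k) by rewrite /B'; case: ifP.
have Bq' : (fun N => \prod_(0 <= k < N) fine (P (X0 @^-1` B' k))) @ \oo -->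
    (\prod_(0 <= k < m) fine (P (X0 @^-1` B k)) * q).
  rewrite -(cvg_shiftn m) /=.
  rewrite (_ : (fun _ => _) = (fun N => \prod_(0 <= k < m) fine (P (X0 @^-1` B k)) *
      \prod_(0 <= k < N) fine (P (X0 @^-1` B k)))); last first.
    apply/funext => N; rewrite (@big_cat_nat _ _ _ m)//= ?leq_addl//; congr (_ * _).
      by apply: eq_big_nat => k /andP[_ km]; rewrite /B' km.
    rewrite -{1}(add0n m) big_addn addnK; apply: eq_bigr => k _.
    by rewrite /B' ltnNge leq_addl/= addnK.
  by apply: cvgM => //; exact: cvg_cst.
have [mE <-] := probability_all B' n _ mB' Bq'.
have [m1 _] := probability_all B n _ mB Bq.
have [m2 _] := probability_all B (n + m)%N _ mB Bq.
apply: le_measure; rewrite ?inE//; first exact: measurableI.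
move=> w /= [h1 h2] k; rewrite /B'; case: ltnP => km; first exact: h1.
by have := h2 (k - m)%N; rewrite -addnA subnKC.
Qed.
End independent_sequence.

(** * The norm of [l_p] and the triangular basis *)

Lemma cabs_ge0 (R : realType) (z : R[i]) : 0 <= cabs z.
Proof. by case: z => x y; exact: sqrtr_ge0. Qed.

(** Makes Minkowski's inequality for the counting measure available. *)
Lemma lpnorm_Lnorm (R : realType) (p : R) (x : nat -> R[i]) : 0 < p ->
  lpnorm p x = Lnorm counting p%:E (EFin \o (fun n => cabs (x n))).
Proof.
move=> p0; rewrite Lnorm_counting//; congr (_ `^ _)%E.
by apply: eq_eseriesr => k _ /=; rewrite ger0_norm ?cabs_ge0.
Qed.

Lemma lpnorm_ge0 (R : realType) (p : R) (x : nat -> R[i]) : (0 <= lpnorm p x)%E.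
Proof. exact: poweR_ge0. Qed.

Lemma lpnormD (R : realType) (p : R) (x y : nat -> R[i]) : 1 <= p ->
  (lpnorm p (x + y)%R <= lpnorm p x + lpnorm p y)%E.
Proof.
move=> p1; have p0 : 0 < p by exact: lt_le_trans p1.
pose f n := cabs (x n); pose g n := cabs (y n).
apply: (@le_trans _ _ (Lnorm counting p%:E (EFin \o (f \+ g)%R))).
  rewrite lpnorm_Lnorm// !Lnorm_counting//.
  have ge0_sum (z : nat -> R) : (0 <= \sum_(k <oo) (`| (z k)%:E | `^ p))%E.
    by apply: nneseries_ge0 => n _ _; exact: poweR_ge0.
  apply: gt0_ler_poweR; rewrite ?in_itv/= ?leey ?andbT ?ge0_sum//.
    by rewrite invr_ge0 ltW.
  apply: lee_nneseries => [n _ _|n _]; rewrite lee_fin ?powR_ge0//.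
  rewrite ge0_ler_powR ?nnegrE ?(ltW p0)//.
  rewrite ger0_norm ?cabs_ge0// ger0_norm ?addr_ge0 ?cabs_ge0//.
  exact: le_normcD.
rewrite !lpnorm_Lnorm//; apply: eminkowski => //.
Qed.

Lemma lpnorm_sum (R : realType) (p : R) (n : nat) (x : nat -> nat -> R[i]) : 1 <= p ->
  (lpnorm p (fun m => (\sum_(k < n) x k m)%R) <= \sum_(k < n) lpnorm p (x k))%E.
Proof.
move=> p1; elim: n => [|n IH].
  rewrite big_ord0 /lpnorm eseries0 ?poweR0r// ?invr_eq0 ?gt_eqF ?(lt_le_trans _ p1)//.
  move=> m _ _; rewrite big_ord0 /cabs Normc.normc0 powR0// gt_eqF//.
  exact: lt_le_trans p1.
rewrite big_ord_recr/=.
rewrite (_ : (fun m => _) = ((fun m => \sum_(k < n) x k m) + x n)); last first.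
  by apply/funext => m; rewrite big_ord_recr.
by apply: le_trans (lpnormD _ _ _ _ p1) _; rewrite leeD2r.
Qed.

Lemma lpnormZ (R : realType) (p : R) (c : R[i]) (x : nat -> R[i]) : 0 < p ->
  lpnorm p (fun m => c * x m) = ((cabs c)%:E * lpnorm p x)%E.
Proof.
move=> p0; rewrite /lpnorm.
rewrite (eq_eseriesr (g := fun n => ((cabs c `^ p)%:E * (cabs (x n) `^ p)%:E)%E)); last first.
  by move=> n _; rewrite -EFinM -powRM ?cabs_ge0// /cabs Normc.normcM.
rewrite nneseriesZl; last by move=> n _; rewrite lee_fin powR_ge0.
rewrite poweRM ?lee_fin ?powR_ge0//; last first.
  by apply: nneseries_ge0 => n _ _; rewrite lee_fin powR_ge0.
by rewrite poweR_EFin -powRrM divff ?gt_eqF// powRr1 ?cabs_ge0.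
Qed.

(** Induction on the length: since [u N N] is nonzero and [u N] vanishes beyond [N], subtracting
    [h N / u N N] times [u N] kills the top coordinate of [h]. *)
Lemma triangular_basis (R : realType) (p : R) (u : nat -> nat -> R[i]) (N : nat)
    (h : nat -> R[i]) :
  admissible p u -> (forall n, (N <= n)%N -> h n = 0) ->
  exists a : nat -> R[i], (forall k, (N <= k)%N -> a k = 0) /\
    forall m, h m = \sum_(k < N) a k * u k m.
Proof.
move=> [u0 udeg _]; elim: N h => [|N IH] h hN.
  by exists (fun=> 0); split=> // m; rewrite big_ord0 hN.
have uNN : u N N != 0.
  case: N {IH hN} => [|N]; first by rewrite u0 /e0 eqxx oner_neq0.
  by case: (udeg N.+1 isT).
have uN_gt n : (N < n)%N -> u N n = 0.
  case: N {IH hN uNN} => [|N] Nn; first by rewrite u0 /e0 gtn_eqF.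
  by case: (udeg N.+1 isT) => _; exact.
have [|a [a0 ha]] := IH (fun m => h m - h N / u N N * u N m).
  move=> n; rewrite leq_eqVlt => /predU1P[<-|Nn]; first by rewrite divfK// subrr.
  by rewrite (hN n)// (uN_gt n)// mulr0 subrr.
exists (fun k => if k == N then h N / u N N else a k); split => [k Nk|m].
  by rewrite gtn_eqF// a0// ltnW.
rewrite big_ord_recr/= eqxx (eq_bigr (fun k : 'I_N => a k * u k m)).
  by rewrite -ha subrK.
by move=> k _; rewrite ltn_eqF.
Qed.

(** * Logarithmic tails and natural density *)

(** Lets a trivial bound by 1 on finitely many indices be absorbed into the constant of a power
    bound. *)
Lemma powR_initial_segment (R : realType) (s : R) (k N : nat) :
  0 <= s -> (k < N)%N -> 1 <= N%:R `^ s * k.+1%:R `^ (- s).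
Proof.
move=> s0 kN; rewrite powRN ler_pdivlMr ?powR_gt0 ?ltr0n// mul1r.
by apply: ge0_ler_powR; rewrite ?nnegrE// ler_nat.
Qed.

(** The logarithm of the radius [delta / sigma^k] grows linearly in [k], so a tail of order
    [(log r)^-(1+beta)] becomes one of order [k^-(1+beta)]. *)
Lemma log_tail_bound d (T : measurableType d) (R : realType) (P : probability T R)
    (X0 : T -> R[i]) (beta delta sigma : R) :
  cRV X0 -> 0 < beta -> 0 < delta -> 0 < sigma < 1 ->
  (limf_esup (fun r : R =>
     ((ln r) `^ (1 + beta))%:E * P [set w | (r <= cabs (X0 w))%R])
     (pinfty_nbhs R) < +oo)%E ->
  exists2 c : R, 0 <= c & forall k,
    (P (~` (X0 @^-1` cball 0%R (delta / sigma ^+ k)%R))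
      <= (c * k.+1%:R `^ (- (1 + beta)))%:E)%E.
Proof.
move=> mX0 beta0 delta0 /andP[sigma0 sigma1].
rewrite limf_esupE => /ereal_inf_lt[_ [V [A [_ AV]] <-] supV].
have [M M0 tail] : exists2 M : R, 0 <= M & forall r, A < r ->
    (((ln r) `^ (1 + beta))%:E * P [set w | (r <= cabs (X0 w))%R] <= M%:E)%E.
  set f := (fun r : R => _ : \bar R) in supV.
  exists (Num.max 0 (fine (ereal_sup [set f x | x in V]))); first by rewrite le_max lexx.
  move=> r Ar; have fr : (f r <= ereal_sup [set f x | x in V])%E.
    by apply: ereal_sup_ubound; exists r => //; exact: AV.
  have fr0 : (0 <= f r)%E by rewrite mule_ge0// lee_fin powR_ge0.
  apply: (le_trans fr); rewrite -(@fineK _ (ereal_sup _)) ?lee_fin ?le_max ?lexx ?orbT//.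
  by rewrite ge0_fin_numE// (le_trans fr0).
(* [lam] is half the slope of [ln r] in [k]; the other half absorbs [ln delta] and the shift from
   [k] to [k + 1]. *)
pose lam := - ln sigma / 2.
have lam0 : 0 < lam by rewrite divr_gt0// oppr_gt0 ln_lt0// sigma0.
(* From [k0] on, the second entry of the maximum yields [(k+1) lam <= ln r], and the first then
   yields [A < r]. *)
pose k0 := Num.bound `|Num.max (A / lam) (1 - ln delta / lam)|.
have hk0 : Num.max (A / lam) (1 - ln delta / lam) < k0%:R.
  by apply: le_lt_trans (ler_norm _) _; rewrite archi_boundP.
move: hk0; rewrite gt_max => /andP[hk1 hk2].
exists (M * lam `^ (- (1 + beta)) + k0%:R `^ (1 + beta)).
  by rewrite addr_ge0 ?mulr_ge0 ?powR_ge0.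
move=> k; have mk := measurableC (measurable_cRV_preimage _ _ _ _ _ mX0
  (cmeasurable_cball _ 0 (delta / sigma ^+ k))).
rewrite (_ : ~` _ = [set w | delta / sigma ^+ k <= cabs (X0 w)]) in mk *; last first.
  apply/seteqP; split => w; rewrite /cball /= subr0; last by rewrite leNgt => /negP.
  by move=> /negP; rewrite -leNgt.
have k1 : 0 < k.+1%:R :> R by rewrite ltr0n.
rewrite mulrDl; have [kk0|k0k] := ltnP k k0.
  apply: (le_trans (probability_le1 P mk)); rewrite lee_fin.
  apply: (@le_trans _ _ (k0%:R `^ (1 + beta) * k.+1%:R `^ (- (1 + beta)))); last first.
    by rewrite lerDr !mulr_ge0// powR_ge0.
  exact: powR_initial_segment (addr_ge0 ler01 (ltW beta0)) kk0.
set r := delta / sigma ^+ k.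
have r0 : 0 < r by rewrite divr_gt0// exprn_gt0.
have k0kR : k0%:R <= k%:R :> R by rewrite ler_nat.
have lnr : k.+1%:R * lam <= ln r.
  rewrite /r ln_div ?posrE ?exprn_gt0// lnXn// -mulr_natr.
  have -> : ln sigma = - (lam * 2) by rewrite /lam divfK// opprK.
  move: hk2; rewrite ltrBlDr -(ltr_pM2r lam0) mulrDl divfK ?gt_eqF// mul1r.
  rewrite -natr1; nra.
have Ar : A < r.
  have : k.+1%:R * lam < r.
    rewrite -(lnK (_ : r \is Num.pos)) ?posrE//.
    apply: (le_lt_trans lnr); apply: lt_le_trans (expR_ge1Dx _).
    by rewrite ltrDr.
  apply: lt_trans; move: hk1; rewrite ltr_pdivrMr// => /lt_le_trans; apply.
  by rewrite ler_pM2r// (le_trans k0kR)// ler_nat.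
have := tail r Ar.
have pfin : P [set w | r <= cabs (X0 w)] \is a fin_num by rewrite fin_num_measure.
rewrite -(fineK pfin) -EFinM !lee_fin; set x := fine _ => hx.
have x0 : 0 <= x by rewrite fine_ge0.
apply: (@le_trans _ _ (M * lam `^ (- (1 + beta)) * k.+1%:R `^ (- (1 + beta)))); last first.
  by rewrite lerDl mulr_ge0 ?powR_ge0.
rewrite -mulrA -powRM ?(ltW lam0)// powRN ler_pdivlMr ?powR_gt0 ?(mulr_gt0 lam0 k1)//.
rewrite mulrC; apply: le_trans hx; rewrite ler_wpM2r// mulrC.
have kl0 : 0 <= k.+1%:R * lam by rewrite mulr_ge0// ltW.
apply: ge0_ler_powR => //; rewrite ?nnegrE//; last exact: le_trans lnr.
by rewrite addr_ge0// ltW.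
Qed.

(** Discarding the indices below [N] lowers each count by at most [N], which is negligible after
    division by [n]. The shift [i.+1] matches counting over [[1, n]]. *)
Lemma pos_density_eventually (R : realType) (f : nat -> bool) (N : nat) (q : R) :
  0 < q -> (fun n => (\sum_(0 <= i < n) (f i.+1)%:R) / n%:R : R) @ \oo --> q ->
  pos_density R (fun n => (N <= n)%N && f n).
Proof.
move=> q0 fq; exists q => //.
have sumE n : \sum_(0 <= i < n) (f i.+1)%:R = (count f (iota 1 n))%:R :> R.
  elim: n => [|n IH]; first by rewrite big_geq.
  by rewrite big_nat_recr// -[n.+1 in RHS]addn1 iotaD count_cat/= IH addn0 natrD.
pose A n := (N <= n)%N && f n.
have Af n : (count A (iota 1 n) <= count f (iota 1 n))%N.
  by apply: sub_count => k /andP[].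
have fA n : (count f (iota 1 n) <= count A (iota 1 n) + N)%N.
  apply: (@leq_trans (count (predU A (fun k => k < N)%N) (iota 1 n))).
    by apply: sub_count => k /= fk; rewrite /A fk andbT; case: leqP.
  have := count_predUI A (fun k => k < N)%N (iota 1 n).
  have : (count (fun k => k < N) (iota 1 n) <= N)%N.
    rewrite -size_filter -[leqRHS](size_iota 0 N); apply: uniq_leq_size.
      by rewrite filter_uniq// iota_uniq.
    by move=> k; rewrite mem_filter !mem_iota; lia.
  lia.
apply: (@squeeze_cvgr _ _ _ _
  (fun n => (\sum_(0 <= i < n) (f i.+1)%:R) / n%:R - N%:R * n%:R^-1)
  (fun n => (\sum_(0 <= i < n) (f i.+1)%:R) / n%:R)); last exact: fq.
  apply: nearW => n; rewrite sumE -mulrBl !ler_wpM2r ?invr_ge0// ?ler_nat//.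
  by rewrite lerBlDr -natrD ler_nat.
rewrite -[X in _ --> X]subr0; apply: cvgB => //.
rewrite -(mulr0 N%:R); apply: cvgM; first exact: cvg_cst.
by rewrite -cvg_shiftS; exact: cvg_harmonic.
Qed.

(** * Norm estimates under geometric decay of [u] *)

Lemma sum_geometric_le (R : realType) (s : R) (n : nat) :
  0 < s < 1 -> \sum_(k < n) s ^+ k <= (1 - s)^-1.
Proof.
move=> /andP[s0 s1]; rewrite -(ler_pM2l (_ : 0 < 1 - s)) ?subr_gt0//.
rewrite divff ?subr_eq0 ?gt_eqF// -opprB mulNr -subrX1 opprB.
by rewrite gerBl exprn_ge0// ltW.
Qed.

Section lpnorm_bounds.
Context (R : realType) (p : R) (u : nat -> nat -> R[i]) (C sigma : R).
Hypotheses (p1 : 1 <= p) (C0 : 0 < C) (sigma01 : 0 < sigma < 1).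
Hypothesis uC : forall k, (lpnorm p (u k) <= (C * (sigma ^+ 2) ^+ k)%:E)%E.

(** Of the decay [sigma^(2k)], one factor [sigma^k] compensates the growth of the coefficient and
    the other keeps the series summable. *)
Let term_le (K z : R) k : 0 <= K -> 0 <= z -> z <= K / sigma ^+ k ->
  (z%:E * lpnorm p (u k) <= (K * C * sigma ^+ k)%:E)%E.
Proof.
have /andP[s0 s1] := sigma01.
move=> K0 z0 zK.
apply: (@le_trans _ _ ((K / sigma ^+ k)%:E * (C * (sigma ^+ 2) ^+ k)%:E)%E).
  by apply: lee_pmul; rewrite ?lee_fin//; exact: lpnorm_ge0.
rewrite -EFinM lee_fin -exprM mulnC exprM expr2 le_eqVlt; apply/orP; left.
by apply/eqP; field; rewrite gt_eqF ?exprn_gt0.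
Qed.

Lemma in_Ep_growth (x : nat -> R[i]) (K : R) :
  (forall k, cabs (x k) <= K / sigma ^+ k) -> in_Ep p u x.
Proof.
move=> xK; have K0 : 0 <= K.
  by have := xK 0%N; rewrite divr1; apply: le_trans; exact: cabs_ge0.
rewrite /in_Ep; apply: (@le_lt_trans _ _ (K * C / (1 - sigma))%:E); last exact: ltry.
apply: lime_le.
  apply: is_cvg_nneseries => k _ _.
  by rewrite mule_ge0 ?lee_fin ?cabs_ge0//; exact: lpnorm_ge0.
apply: nearW => n; rewrite big_mkord.
apply: (@le_trans _ _ (\sum_(k < n) (K * C * sigma ^+ k)%:E)%E).
  by apply: lee_sum => k _; apply: term_le => //; exact: cabs_ge0.
rewrite sumEFin lee_fin -mulr_sumr ler_wpM2l ?sum_geometric_le//.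
by rewrite mulr_ge0// ltW.
Qed.

(** Since [N <= n], the sum defining [Tn] covers the whole expansion of [h], so the difference has
    coefficients [x (n + k) - a k]; the triangle inequality and a geometric sum conclude. *)
Lemma lpnorm_Tn_lt (h a x : nat -> R[i]) (N n : nat) (delta eta : R) :
  0 < delta -> delta * C / (1 - sigma) < eta ->
  (forall k, (N <= k)%N -> a k = 0) ->
  (forall m, h m = \sum_(k < N) a k * u k m) -> (N <= n)%N ->
  (forall k, cabs (x (n + k)%N - a k) < delta / sigma ^+ k) ->
  (lpnorm p (Tn u n x - h)%R < eta%:E)%E.
Proof.
move=> delta0 deta a0 ha Nn xa.
rewrite (_ : (Tn u n x - h)%R =
    (fun m => \sum_(k < n.+1) (x (n + k)%N - a k) * u k m)); last first.
  apply/funext => m; rewrite /Tn !fctE ha.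
  have -> : \sum_(k < N) a k * u k m = \sum_(k < n.+1) a k * u k m.
    rewrite (big_ord_widen n.+1 (fun k => a k * u k m)) ?(leqW Nn)// big_mkcond/=.
    by apply: eq_bigr => k _; case: ltnP => // Nk; rewrite a0// mul0r.
  by rewrite -sumrB; apply: eq_bigr => k _; rewrite mulrBl addnC.
apply: (le_lt_trans
  (lpnorm_sum _ _ n.+1 (fun k m => (x (n + k)%N - a k) * u k m) p1)).
apply: (@le_lt_trans _ _ (\sum_(k < n.+1) (delta * C * sigma ^+ k)%:E)%E).
  apply: lee_sum => k _; rewrite lpnormZ ?(lt_le_trans _ p1)//.
  by apply: term_le; [exact: ltW|exact: cabs_ge0|exact: ltW].
rewrite sumEFin lte_fin -mulr_sumr; apply: le_lt_trans deta.
by rewrite ler_wpM2l ?sum_geometric_le// mulr_ge0// ltW.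
Qed.
End lpnorm_bounds.

(** * Almost sure statements and conclusion *)

Lemma ae_pos_density d (T : measurableType d) (R : realType) (P : probability T R)
    (X0 : T -> R[i]) (X : nat -> T -> R[i]) (B : nat -> set R[i]) (beta c : R)
    (N : nat) :
  cRV X0 -> (forall k, cRV (X k)) -> (forall k, same_law P (X k) X0) ->
  cindependent P X -> (forall k, cmeasurable (B k)) -> 0 < beta ->
  (forall k, 0 < P (X0 @^-1` B k))%E ->
  (forall k, P (~` (X0 @^-1` B k)) <= (c * k.+1%:R `^ (- (1 + beta)))%:E)%E ->
  {ae P, forall w,
    pos_density R (fun n => (N <= n)%N && `[< forall k, B k (X (n + k)%N w) >])}.
Proof.
move=> mX0 mX lawX indepX mB beta0 B0 Bc.
have mXB k := measurable_cRV_preimage _ _ _ _ _ mX0 (mB k).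
pose b k := fine (P (X0 @^-1` B k)).
have bE k : P (X0 @^-1` B k) = (b k)%:E by rewrite fineK// fin_num_measure.
have b01 k : 0 < b k <= 1 by rewrite -lte_fin -lee_fin -bE B0 probability_le1.
have bc k : 1 - b k <= c * k.+1%:R `^ (- (1 + beta)).
  by rewrite -lee_fin EFinB -bE -probability_setC.
have [q [C [/andP[q0 q1] C0 bq piq]]] := infinite_product _ _ _ _ beta0 b01 bc.
(* Times start at 1, as natural density counts over [[1, n]]. *)
pose G n := [set w | forall k, B k (X (n.+1 + k)%N w)].
have GP n := probability_all _ _ _ _ _ _ mX lawX indepX B n.+1 q mB bq.
have GG n m : (P (G n `&` G (n + m)%N) <=
    (q ^+ 2 + C * m.+1%:R `^ (- beta))%:E)%E.
  (* The bound [(q + t) * q] on the product is at most [q^2 + t], because [q <= 1]. *)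
  have := probability_pair_le _ _ _ _ _ _ mX lawX indepX B n.+1 m q mB bq.
  rewrite addSn => /le_trans; apply; rewrite lee_fin.
  have := piq m; have : 0 <= C * m.+1%:R `^ (- beta) by rewrite mulr_ge0 ?powR_ge0.
  rewrite -/(b _); set pm := \prod_(_ <= _ < _) _; set t := C * _; nra.
have := strong_law_weakly_dependent _ _ _ P G q C beta
  (fun n => (GP n).1) (fun n => (GP n).2) beta0 C0 GG.
apply: filterS => w Gw; apply: pos_density_eventually q0 _.
apply: cvg_trans Gw; apply: near_eq_cvg; apply: nearW => n /=.
congr (_ / _); apply: eq_bigr => i _; rewrite indicE.
Qed.

(** Borel-Cantelli: the probabilities of the events [F k] that the bound fails are summable, so
    their limsup is the exceptional null set. *)
Lemma ae_eventually_bounded d (T : measurableType d) (R : realType)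
    (P : probability T R) (X0 : T -> R[i]) (X : nat -> T -> R[i]) (r : nat -> R)
    (beta c : R) :
  cRV X0 -> (forall k, cRV (X k)) -> (forall k, same_law P (X k) X0) ->
  0 < beta -> 0 <= c ->
  (forall k, P (~` (X0 @^-1` cball 0%R (r k))) <=
    (c * k.+1%:R `^ (- (1 + beta)))%:E)%E ->
  {ae P, forall w, exists n, forall k, (n <= k)%N -> cabs (X k w) < r k}.
Proof.
move=> mX0 mX lawX beta0 c0 Xr.
have mB k := cmeasurable_cball _ 0 (r k).
pose F k := ~` (X k @^-1` cball 0 (r k)).
have mF k : measurable (F k) by apply: measurableC; exact: measurable_cRV_preimage.
have PF k : (P (F k) <= (c * k.+1%:R `^ (- (1 + beta)))%:E)%E.
  have mXk := measurable_cRV_preimage _ _ _ _ _ (mX k) (mB k).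
  have mX0k := measurable_cRV_preimage _ _ _ _ _ mX0 (mB k).
  by apply: le_trans (Xr k); rewrite /F !probability_setC// (lawX k _ (mB k)).
have PF0 : P (lim_sup_set F) = 0.
  apply: lim_sup_set_cvg0 => //; apply: le_lt_trans (powRN_summable _ _ _ beta0 c0).
  by apply: lee_nneseries => [k _ _|k _]; [exact: measure_ge0|exact: PF].
exists (lim_sup_set F); split => //.
  by apply: bigcap_measurable => // k _; exact: bigcup_measurable.
move=> w /= nw n _; apply: contra_notP nw => nF; exists n => k nk.
apply: contra_notT nF; rewrite -leNgt => rk; exists k => //.
by rewrite /F /cball /= subr0 => /(le_lt_trans rk); rewrite ltxx.
Qed.

Theorem theorem3p1 (R : realType) (p : R) (u : nat -> nat -> R[i])
  (d : measure_display) (T : measurableType d) (P : probability T R)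
  (X0 : T -> R[i]) (X : nat -> T -> R[i]) :
  1 <= p ->
  admissible p u ->
  (exists2 Cst : R, 0 < Cst & exists2 tau : R, 0 < tau < 1 &
     forall k, (lpnorm p (u k) <= (Cst * tau ^+ k)%:E)%E) ->
  cRV X0 ->
  full_support P X0 ->
  (exists2 beta : R, 0 < beta &
     (limf_esup (fun r : R =>
        ((ln r) `^ (1 + beta))%:E * P [set w | (r <= cabs (X0 w))%R])
        (pinfty_nbhs R) < +oo)%E) ->
  (forall k, cRV (X k)) ->
  (forall k, same_law P (X k) X0) ->
  cindependent P X ->
  {ae P, forall w, in_Ep p u (fun k => X k w)} /\
  (forall h : nat -> R[i], c00 h -> forall eta : R, 0 < eta ->
     {ae P, forall w, exists A : nat -> bool, pos_density R A /\
        forall n, A n -> (lpnorm p (Tn u n (fun k => X k w) - h)%R < eta%:E)%E}).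
Proof.
move=> p1 adm [C C0 [tau /andP[tau0 tau1] utau]] mX0 supp [beta beta0 tail] mX lawX indepX.
pose sigma := Num.sqrt tau.
have s0 : 0 < sigma by rewrite sqrtr_gt0.
have s2 : sigma ^+ 2 = tau by rewrite sqr_sqrtr// ltW.
have s1 : sigma < 1 by rewrite -(@ltr_pXn2r _ 2) ?nnegrE ?ltW// s2 expr1n.
have s01 : 0 < sigma < 1 by rewrite s0.
have uC k : (lpnorm p (u k) <= (C * (sigma ^+ 2) ^+ k)%:E)%E by rewrite s2.
split.
  have [c c0 hc] := log_tail_bound _ _ _ _ _ _ _ _ mX0 beta0 ltr01 s01 tail.
  apply: filterS (ae_eventually_bounded _ _ _ _ _ _ _ _ _ mX0 mX lawX beta0 c0 hc).
  (* The [1] covers the indices from [n] on, where [|X_k| < 1 / sigma^k]; the sum covers the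
     finitely many earlier ones. *)
  move=> w [n hn]; pose K := 1 + \sum_(0 <= k < n) cabs (X k w).
  have Sge0 i j : 0 <= \sum_(i <= l < j) cabs (X l w).
    by apply: sumr_ge0 => l _; exact: cabs_ge0.
  apply: (in_Ep_growth _ _ _ _ _ C0 s01 uC _ K) => k.
  have sk : 1 <= (sigma ^+ k)^-1.
    by rewrite invf_ge1 ?exprn_gt0// exprn_ile1 ?ltW.
  have [nk|kn] := leqP n k.
    apply: le_trans (ltW (hn k nk)) _.
    by rewrite ler_wpM2r ?invr_ge0 ?exprn_ge0 ?(ltW s0)// lerDl.
  apply: (@le_trans _ _ K); last by rewrite ler_peMr// addr_ge0.
  rewrite /K (@big_cat_nat _ _ _ k)//= ?(ltnW kn)// (big_ltn kn).
  by have := Sge0 0%N k; have := Sge0 k.+1 n; lra.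
move=> h [N hN] eta eta0.
have [a [a0 ha]] := triangular_basis _ _ _ _ _ adm hN.
(* Chosen so that the geometric bound [delta * C / (1 - sigma)] equals [eta / 2]. *)
pose delta := eta * (1 - sigma) / (2 * C).
have delta0 : 0 < delta by rewrite divr_gt0 ?mulr_gt0// subr_gt0.
have deta : delta * C / (1 - sigma) < eta.
  have -> : delta * C / (1 - sigma) = eta / 2.
    by rewrite /delta; field; rewrite subr_eq0 !gt_eqF.
  lra.
have [c c0 hc] := log_tail_bound _ _ _ _ _ _ _ _ mX0 beta0 delta0 s01 tail.
pose B k := cball (a k) (delta / sigma ^+ k).
have mB k : cmeasurable (B k) by exact: cmeasurable_cball.
have B0 k : (0 < P (X0 @^-1` B k))%E.
  have r0 : 0 < delta / sigma ^+ k by rewrite divr_gt0 ?exprn_gt0.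
  apply: supp; last by exists (a k); rewrite /B /cball /= subrr /cabs Normc.normc0.
  move=> z; rewrite /B /cball /= -subr_gt0 => e0; eexists; first exact: e0.
  move=> w; rewrite ltrBrDr; apply: le_lt_trans.
  by rewrite -[w - a k](subrKA z); exact: le_normcD.
(* For [k >= N] the ball is centred at 0 and the tail bound applies; for the finitely many [k < N]
   the trivial bound 1 is paid for by [N^(1+beta)]. *)
have hB k : (P (~` (X0 @^-1` B k)) <=
    ((c + N%:R `^ (1 + beta)) * k.+1%:R `^ (- (1 + beta)))%:E)%E.
  rewrite mulrDl; have [Nk|kN] := leqP N k.
    rewrite /B a0//; apply: (le_trans (hc k)).
    by rewrite lee_fin lerDl mulr_ge0 ?powR_ge0.
  have mXB := measurable_cRV_preimage _ _ _ _ _ mX0 (mB k).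
  apply: (le_trans (probability_le1 P (measurableC mXB))); rewrite lee_fin.
  apply: (le_trans (powR_initial_segment _ _ _ _ (addr_ge0 ler01 (ltW beta0)) kN)).
  by rewrite lerDr mulr_ge0 ?powR_ge0.
have := ae_pos_density _ _ _ _ _ _ _ _ _ N mX0 mX lawX indepX mB beta0 B0 hB.
apply: filterS => w Aw; eexists; split; first exact: Aw.
move=> n /andP[Nn /asboolP hn].
exact: (lpnorm_Tn_lt _ _ _ _ _ p1 C0 s01 uC _ _ _ _ _ _ _ delta0 deta a0 ha Nn hn).
Qed.
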